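(* Let $n$ be a positive integer and let $k=\sqrt{3n-2}$. Then $$1-\frac{3n^2-2n+k^3}{(n+k)^3}$$ is not a jump for $r=3$. That is, for every $c>0$ there exists a family $\mathcal{F}$ of $3$-uniform hypergraphs with $\pi(\mathcal{F})\in\left(\alpha,\alpha+c\right)$, where $\alpha=1-\frac{3n^2-2n+k^3}{(n+k)^3}$.
   Context: An $r$-graph is an $r$-uniform hypergraph. For a family $\mathcal{F}$ of $r$-graphs, $\mathrm{ex}(m,\mathcal{F})$ is the maximum number of edges in an $r$-graph on $m$ vertices containing no member of $\mathcal{F}$ as a subgraph, and the Tur\'an density is $\pi(\mathcal{F})=\lim_{m\to\infty}\mathrm{ex}(m,\mathcal{F})/\binom{m}{r}$ (this limit exists). A number $\alpha\in[0,1)$ is a jump for $r$ if there exists $c>0$ (depending on $\alpha$ and $r$) such that no family $\mathcal{F}$ of $r$-graphs has $\pi(\mathcal{F})\in(\alpha,\alpha+c)$. *)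

(* Defs.v *)
From HB Require Import structures.
From mathcomp Require Import all_boot all_order all_algebra.
From mathcomp Require Import all_classical all_reals all_analysis.

Set Implicit Arguments.
Unset Strict Implicit.
Unset Printing Implicit Defensive.

Import Order.TTheory GRing.Theory Num.Theory.
Import numFieldNormedType.Exports.

Local Open Scope classical_set_scope.
Local Open Scope ring_scope.

Definition uniform (r : nat) (V : finType) (E : {set {set V}}) : bool :=
  [forall e in E, #|e| == r].

(* Vertex sets are taken to be 'I_v, so that families are sets in the sense of
   classical_sets; this loses nothing up to isomorphism. *)
Record rgraph (r : nat) := RGraph {
  nverts : nat;
  edges : {set {set 'I_nverts}};
  edges_uniform : uniform r edges }.

(* Not necessarily induced. *)
Definition contains (r : nat) (V : finType) (E : {set {set V}})
    (H : rgraph r) : Prop :=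
  exists f : 'I_(nverts H) -> V,
    injective f /\ forall e, e \in edges H -> f @: e \in E.

Definition free_of (r : nat) (F : set (rgraph r)) (V : finType)
    (E : {set {set V}}) : Prop :=
  forall H, F H -> ~ contains E H.

(* The value is 0 when no r-graph on m vertices is F-free, which happens only
   if F has an edgeless member on at most m vertices. *)
Definition ex_turan (r m : nat) (F : set (rgraph r)) : nat :=
  \max_(E : {set {set 'I_m}} | uniform r E && `[< free_of F E >]) #|E|.

Definition turan_density (R : realType) (r : nat) (F : set (rgraph r)) : R :=
  limn (fun m => (ex_turan m F)%:R / 'C(m, r)%:R : R).

(* Families may be infinite.  The requirement 0 <= alpha < 1 is left out: densities
   lie in [0, 1], so every real outside [0, 1) has this property. *)
Definition jump (R : realType) (r : nat) (alpha : R) : Prop :=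
  exists c : R, 0 < c /\
    forall F : set (rgraph r),
      ~ (alpha < turan_density R F /\ turan_density R F < alpha + c).

(* Main.v *)
(** Put w0 = k / (n + k); since k^2 = 3n - 2 the number in question is
    alpha = 1 - w0^2, the Lagrangian of the pattern with n + 1 parts in which
    part W has weight w0, the parts V_1, ..., V_n share the weight 1 - w0, and
    the only forbidden triples are those inside W and those inside the union of
    the V_i that meet some V_i twice.

    Let F_s be the family of 3-graphs on at most s vertices whose Lagrangian
    exceeds alpha.  An F_s-free graph on s vertices has at most alpha s^3 / 6
    edges, so the Turan density of F_s is at most alpha s^2 / ((s-1)(s-2)),
    which tends to alpha.  It remains to see that it is strictly larger than
    alpha.  Following Frankl and Rodl, replace W by t distinct vertices: the
    triples with two equal vertices in W are lost, which costs O(1/t) of the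
    density, and a triple system S inside W with at least C t^2 edges more than
    makes up for it.  If moreover any v <= s vertices span at most v - 2 edges of
    S, then small subgraphs still have Lagrangian at most alpha: on them S is no
    better than a single edge with weights a, b, w - a - b, where a and b are the
    two largest weights in W, and 6ab(w - a - b) is compensated by the loss
    3(1 - w)(a^2 + b^2) and by the convexity gap of w^3 + (k/n)^2 (1 - w)^3. *)
Require Import Defs.
From HB Require Import structures.
From mathcomp Require Import all_boot all_order all_algebra.
From mathcomp Require Import all_classical all_reals all_analysis.
From mathcomp Require Import ring lra zify.
From mathcomp Require Import fintype finset.

Set Implicit Arguments.
Unset Strict Implicit.
Unset Printing Implicit Defensive.

Import Order.TTheory GRing.Theory Num.Theory.
Import numFieldNormedType.Exports.
Import Defs.

Local Open Scope set_scope.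
Local Open Scope ring_scope.

(** * Turan densities *)

Lemma free_of_comp (r : nat) (F : set (rgraph r)) (V W : finType)
    (E : {set {set V}}) (D : {set {set W}}) (g : W -> V) :
  injective g -> (forall e, e \in D -> g @: e \in E) ->
  free_of F E -> free_of F D.
Proof.
move=> g_inj gDE frE H FH [f [f_inj fH]]; case: (frE H FH).
exists (g \o f); split; first exact: inj_comp.
by move=> e eH; rewrite imset_comp; apply/gDE/fH.
Qed.

Lemma leq_ex_turan (r m : nat) (F : set (rgraph r)) (E : {set {set 'I_m}}) :
  uniform r E -> free_of F E -> (#|E| <= ex_turan m F)%N.
Proof.
move=> uE fE; rewrite /ex_turan.
have PE : uniform r E && `[< free_of F E >] by rewrite uE; apply/asboolP.
exact: (leq_bigmax_cond (F := fun E : {set {set 'I_m}} => #|E|) E PE).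
Qed.

Lemma ex_turan_attained (r m : nat) (F : set (rgraph r)) :
  ex_turan m F = 0%N \/ exists E : {set {set 'I_m}},
    [/\ uniform r E, free_of F E & ex_turan m F = #|E|].
Proof.
pose P := [pred E : {set {set 'I_m}} | uniform r E && `[< free_of F E >]].
have -> : ex_turan m F = \max_(E in P) #|E| by [].
have [/(eq_bigmax_cond (fun E : {set {set 'I_m}} => #|E|))|] := ltnP 0 #|P|.
  by case=> E /andP[uE /asboolP fE] ->; right; exists E.
rewrite leqn0 => /eqP/card0_eq P0; left.
exact: big_pred0.
Qed.

(** Averaging over vertex deletions: an edge of an extremal graph survives in [m.+1 - r] of its
    [m.+1] vertex-deleted subgraphs, and each of these is again [F]-free. *)
Lemma ex_turan_succ (r m : nat) (F : set (rgraph r)) :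
  ((m.+1 - r) * ex_turan m.+1 F <= m.+1 * ex_turan m F)%N.
Proof.
have [->|[E [uE fE ->]]] := ex_turan_attained m.+1 F; first by rewrite muln0.
pose D (i : 'I_m.+1) := [set e : {set 'I_m} | lift i @: e \in E].
have leD i : (#|D i| <= ex_turan m F)%N.
  apply: leq_ex_turan.
    apply/forall_inP => e; rewrite inE => /(forall_inP uE).
    by rewrite card_imset //; exact: lift_inj.
  apply: (free_of_comp (g := lift i) _ _ fE) => [|e]; first exact: lift_inj.
  by rewrite inE.
have le_del i : (#|[set e in E | i \notin e]| <= #|D i|)%N.
  apply: leq_trans (leq_imset_card (fun e : {set 'I_m} => lift i @: e) _).
  apply: subset_leq_card; apply/subsetP => e; rewrite inE => /andP[eE ie].
  have ee : e = lift i @: (lift i @^-1: e).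
    apply/setP => x; apply/idP/imsetP => [xe|[y]]; last by rewrite inE => ? ->.
    case: (unliftP i x) xe => [y -> ye|-> ie']; last by rewrite ie' in ie.
    by exists y => //; rewrite inE.
  by apply/imsetP; exists (lift i @^-1: e) => //; rewrite inE -ee.
have <- : (\sum_(i < m.+1) #|[set e in E | i \notin e]| =
          (m.+1 - r) * #|E|)%N.
  under eq_bigr => i _ do rewrite -sum1dep_card big_mkcondr.
  rewrite exchange_big /= mulnC -sum_nat_const; apply: eq_bigr => e eE.
  rewrite -big_mkcond sum1_card -(eqP (forall_inP uE e eE)).
  rewrite -[X in (X - _)%N](card_ord m.+1) -(cardC (mem e)) addKn.
  by apply: eq_card => i; rewrite !inE.
rewrite -[X in (X * _)%N](card_ord m.+1) -sum_nat_const.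
by apply: leq_sum => i _; apply: leq_trans (le_del i) (leD i).
Qed.

Section TuranDensity.
Variables (R : realType) (r : nat) (F : set (rgraph r)).

Let ratio m : R := (ex_turan m F)%:R / 'C(m, r)%:R.

Lemma turan_ratio_succ (m : nat) : (r <= m)%N -> ratio m.+1 <= ratio m.
Proof.
move=> rm; rewrite /ratio.
rewrite ler_pdivrMr ?ltr0n ?bin_gt0 ?(leqW rm) //.
rewrite mulrAC ler_pdivlMr ?ltr0n ?bin_gt0 //.
rewrite -!natrM ler_nat -(@leq_pmul2l (m.+1 - r)) ?subn_gt0 ?ltnS //.
rewrite mulnA [leqRHS]mulnCA -(mul_bin_down m.+1 r) [leqRHS]mulnCA [leqRHS]mulnA.
by rewrite leq_mul2r ex_turan_succ orbT.
Qed.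

(** The shift by [r] skips the indices where ['C(m, r)] is 0 and the quotient takes the default
    value 0; monotonicity could fail there. *)
Let shift_ratio_noninc : nonincreasing_seq (fun m => ratio (m + r)%N).
Proof.
by apply/nonincreasing_seqP => m; rewrite addSn turan_ratio_succ ?leq_addl.
Qed.

Let shift_ratio_cvg : cvgn (fun m => ratio (m + r)%N).
Proof.
apply: nonincreasing_is_cvgn => //; exists 0 => _ [m _ <-].
by rewrite divr_ge0.
Qed.

Let turan_density_shift :
  turan_density R F = limn (fun m => ratio (m + r)%N).
Proof.
have /cvg_ex[l hl] := shift_ratio_cvg.
rewrite (cvg_lim _ hl) // /turan_density; apply: cvg_lim => //.
by move: hl; rewrite (@cvg_shiftn r).
Qed.

Lemma turan_density_le (m : nat) :
  (r <= m)%N -> turan_density R F <= (ex_turan m F)%:R / 'C(m, r)%:R.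
Proof.
move=> rm; rewrite turan_density_shift.
have := nonincreasing_cvgn_ge shift_ratio_noninc shift_ratio_cvg (m - r).
by rewrite subnK.
Qed.

Lemma turan_density_ge (x : R) :
  (forall m, (r <= m)%N -> x <= (ex_turan m F)%:R / 'C(m, r)%:R) ->
  x <= turan_density R F.
Proof.
move=> hx; rewrite turan_density_shift; apply: limr_ge => //.
by apply: nearW => m; apply: hx; rewrite leq_addl.
Qed.
End TuranDensity.

(** * Random choices *)

Section ProductMeasure.
Variables (R : realFieldType) (I J : finType) (mu : J -> R).
Hypotheses (mu_ge0 : forall j, 0 <= mu j) (mu1 : \sum_j mu j = 1).

Definition prodw (f : {ffun I -> J}) : R := \prod_i mu (f i).

Lemma prodw_ge0 f : 0 <= prodw f.
Proof. exact: prodr_ge0. Qed.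

(** Independence under the product measure: the product distributes over the sums, and coordinates
    outside [A] contribute a factor 1 by [mu1]. *)
Lemma sum_prodw_indep (A : {set I}) (g : I -> J -> R) :
  \sum_f prodw f * \prod_(i in A) g i (f i) =
  \prod_(i in A) \sum_j mu j * g i j.
Proof.
rewrite [RHS]big_mkcond /=.
transitivity (\prod_i \sum_j mu j * (if i \in A then g i j else 1)).
  rewrite bigA_distr_bigA; apply: eq_bigr => f _.
  by rewrite /prodw [X in _ * X]big_mkcond -big_split.
apply: eq_bigr => i _; case: ifP => // _.
by under eq_bigr do rewrite mulr1.
Qed.

Lemma sum_prodw : \sum_f prodw f = 1.
Proof.
have := sum_prodw_indep set0 (fun _ _ => 1).
rewrite [RHS]big_pred0 => [<-|i]; last by rewrite inE.
apply: eq_bigr => f _.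
by rewrite big_pred0 ?mulr1 // => i; rewrite inE.
Qed.

Lemma first_moment (X : {ffun I -> J} -> R) (c : R) :
  c <= \sum_f prodw f * X f -> exists f, c <= X f.
Proof.
move=> hc; apply: contrapT => /forallNP ltX.
have {}ltX f : X f < c by rewrite ltNge; apply/negP/ltX.
suff: \sum_f prodw f * X f < c by rewrite ltNge hc.
rewrite -[ltRHS]mul1r -sum_prodw mulr_suml.
have le f : prodw f * X f <= prodw f * c.
  by rewrite ler_wpM2l ?prodw_ge0 // ltW.
have [f f_gt0] : exists f, 0 < prodw f.
  apply: contrapT => /forallNP le0; have := oner_neq0 R.
  rewrite -sum_prodw big1 ?eqxx // => f _; apply/eqP.
  by rewrite eq_le prodw_ge0 leNgt andbT; apply/negP/le0.
rewrite (bigD1 f) //= [ltRHS](bigD1 f) //=.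
by rewrite ltr_leD ?ltr_pM2l // ler_sum.
Qed.

(** [h] is a combination of products of point indicators in its three arguments; [sum_prodw_indep]
    applies to each product since [a], [b], [c] are distinct. *)
Lemma sum_prodw3 (h : J -> J -> J -> R) (a b c : I) :
  a != b -> a != c -> b != c ->
  \sum_f prodw f * h (f a) (f b) (f c) =
  \sum_j1 \sum_j2 \sum_j3 mu j1 * mu j2 * mu j3 * h j1 j2 j3.
Proof.
move=> ab ac bc.
have big3 (G : I -> R) : \prod_(i in [set a; b; c]) G i = G a * G b * G c.
  rewrite -setUA !big_setU1 ?big_set1 ?inE ?(negPf ab) ?(negPf ac) //=.
  by rewrite mulrA.
pose g j1 j2 j3 (i : I) (j : J) : R :=
  (j == if i == a then j1 else if i == b then j2 else j3)%:R.
have gE j1 j2 j3 : \sum_f prodw f * \prod_(i in [set a; b; c]) g j1 j2 j3 i (f i)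
    = mu j1 * mu j2 * mu j3.
  have delta (j0 : J) : \sum_j mu j * (j == j0)%:R = mu j0.
    rewrite (bigD1 j0) //= eqxx mulr1 big1 ?addr0 // => j /negPf ->.
    by rewrite mulr0.
  rewrite sum_prodw_indep big3 /g eqxx !delta.
  by rewrite [b == a]eq_sym (negPf ab) eqxx [c == a]eq_sym (negPf ac)
    [c == b]eq_sym (negPf bc).
under [RHS]eq_bigr => j1 _ do under eq_bigr => j2 _ do
  under eq_bigr => j3 _ do rewrite -gE mulr_suml.
under [RHS]eq_bigr => j1 _ do under eq_bigr => j2 _ do rewrite exchange_big /=.
under [RHS]eq_bigr => j1 _ do rewrite exchange_big /=.
rewrite exchange_big /=; apply: eq_bigr => f _.
have delta (j0 : J) (G : J -> R) : \sum_j (j0 == j)%:R * G j = G j0.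
  rewrite (bigD1 j0) //= eqxx mul1r big1 ?addr0 // => j.
  by rewrite eq_sym => /negPf ->; rewrite mul0r.
under [RHS]eq_bigr => j1 _ do under eq_bigr => j2 _ do
  under eq_bigr => j3 _ do rewrite big3 /g eqxx [b == a]eq_sym (negPf ab) eqxx
    [c == a]eq_sym (negPf ac) [c == b]eq_sym (negPf bc) -!mulrA.
under [RHS]eq_bigr => j1 _ do under eq_bigr => j2 _ do
  rewrite -!mulr_sumr delta.
under [RHS]eq_bigr => j1 _ do rewrite -!mulr_sumr delta.
by rewrite -!mulr_sumr delta.
Qed.
End ProductMeasure.

(** Keep each point independently with probability [p], then remove one point from every [B k] that
    survives entirely. The bound is the expected number of kept points of [A] minus that of
    surviving [B k]. *)
Lemma deletion_method (R : realFieldType) (T K : finType) (A : {set T})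
    (B : K -> {set T}) (P : pred K) (p : R) :
  0 <= p -> p <= 1 -> (forall k, P k -> B k != set0) ->
  exists S : {set T}, [/\ S \subset A, forall k, P k -> ~~ (B k \subset S)
    & p * #|A|%:R - \sum_(k | P k) p ^+ #|B k| <= #|S|%:R].
Proof.
move=> p_ge0 p_le1 B_neq0.
pose mu (b : bool) : R := if b then p else 1 - p.
have mu_ge0 b : 0 <= mu b by case: b; rewrite /mu ?subr_ge0.
have mu1 : \sum_b mu b = 1 by rewrite big_bool /= addrC subrK.
pose on (f : {ffun T -> bool}) (X : {set T}) := \prod_(x in X) (f x)%:R : R.
have sum_on (X : {set T}) : \sum_f prodw mu f * on f X = p ^+ #|X|.
  rewrite (sum_prodw_indep mu1 X (fun _ b => b%:R)) -prodr_const.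
  by apply: eq_bigr => x _; rewrite big_bool /= mulr1 mulr0 addr0.
have onE (f : {ffun T -> bool}) (X : {set T}) :
    on f X = (X \subset [set x | f x])%:R.
  rewrite /on; have [/subsetP sX|] := boolP (X \subset _).
    by rewrite big1 // => x /sX; rewrite inE => ->.
  by case/subsetPn => x xX; rewrite inE => /negPf fx; rewrite (bigD1 x) //= fx mul0r.
have [f] : exists f, p * #|A|%:R - \sum_(k | P k) p ^+ #|B k| <=
    \sum_(x in A) on f [set x] - \sum_(k | P k) on f (B k).
  apply: (first_moment mu_ge0 mu1).
  rewrite le_eqVlt; apply/orP; left; apply/eqP.
  under [RHS]eq_bigr do rewrite mulrBr !mulr_sumr.
  rewrite sumrB exchange_big [X in _ = _ - X]exchange_big /=.
  congr (_ - _); last by apply: eq_bigr => k _; rewrite sum_on.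
  under eq_bigr do rewrite sum_on cards1 expr1.
  by rewrite sumr_const mulr_natr.
move=> le_f; pose S0 := A :&: [set x | f x].
pose bad := [set k | P k && (B k \subset S0)].
pose del := [set x | Some x \in [set [pick y in B k] | k in bad]].
exists (S0 :\: del); split.
- by rewrite (subset_trans (subsetDl _ _)) // subsetIl.
- move=> k Pk; apply/negP => sB.
  have k_bad : k \in bad by rewrite inE Pk (subset_trans sB (subsetDl _ _)).
  case: (pickP (mem (B k))) (imset_f (fun k => [pick y in B k]) k_bad) => /=.
    move=> x xB x_del; move: (subsetP sB x xB).
    by rewrite !inE x_del.
  move=> B0 _; have /set0Pn[x xB] := B_neq0 k Pk.
  by move: (B0 x); rewrite /= xB.
apply: (le_trans le_f).
have -> : \sum_(x in A) on f [set x] = #|S0|%:R.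
  rewrite -sum1_card natr_sum; under [RHS]eq_bigl do rewrite inE.
  rewrite [RHS]big_mkcondr; apply: eq_bigr => x _.
  by rewrite onE sub1set; case: ifP.
have : (#|bad|%:R : R) <= \sum_(k | P k) on f (B k).
  rewrite -sum1_card natr_sum.
  under eq_bigl do rewrite inE.
  rewrite big_mkcondr; apply: ler_sum => k Pk.
  rewrite onE subsetI; case: ifP => [/andP[_ ->]|_] //.
have : (#|S0|%:R : R) <= #|S0 :\: del|%:R + #|bad|%:R.
  rewrite -natrD ler_nat -(cardsID del S0) addnC leq_add2l.
  apply: leq_trans (subset_leq_card (subsetIr _ _)) _.
  apply: leq_trans (leq_imset_card (fun k => [pick y in B k]) _).
  have Some_inj' : injective (@Some T) by move=> x y [].
  rewrite -(card_imset _ Some_inj'); apply: subset_leq_card.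
  by apply/subsetP => _ /imsetP[x + ->]; rewrite inE.
lra.
Qed.

(** * Sparse triple systems *)

Lemma bin3_natr (R : numFieldType) (m : nat) :
  'C(m, 3)%:R * 6 = m%:R * (m%:R - 1) * (m%:R - 2) :> R.
Proof.
rewrite -[6](_ : (3`!)%:R = _) // -natrM bin_ffact.
case: m => [|[|[|m]]]; rewrite ?ffactnS ?ffactn0 /= ?muln0 ?mul0n ?muln1;
  rewrite ?natrM -?natr1; ring.
Qed.

Lemma leq_bin_expn (m k : nat) : ('C(m, k) <= m ^ k)%N.
Proof.
apply: (@leq_trans (m ^_ k)).
  by rewrite -bin_ffact leq_pmulr ?fact_gt0.
elim: k m => [|k IH] m; first by rewrite ffactn0.
rewrite ffactnS expnS leq_mul2l; apply/orP; right.
by apply: leq_trans (IH _) _; case: (k) => // j; rewrite leq_exp2r ?leq_pred.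
Qed.

(* Frankl and Rödl: the expected number of configurations of [v] vertices
   carrying [v - 1] random edges is [O(t)] when the edge probability is
   [D / t], whereas the expected number of edges is of order [D * t ^ 2]. *)
Lemma sparse_triple_system (C s : nat) :
  exists t (S : {set {set 'I_t}}), [/\ (0 < t)%N, uniform 3 S,
    forall U : {set 'I_t}, (#|U| <= s)%N ->
      (#|[set e in S | e \subset U]| <= #|U| - 2)%N
    & (C * t ^ 2 <= #|S|)%N].
Proof.
(* With edge probability [D / t] and [t >= 4], at least [D t^2 / 24 = (C + 1) t^2] edges are
   expected. [M] bounds the number of set systems on at most [s] points, and the expected number of
   bad configurations is at most [K t <= t^2], which leaves [C t^2]. *)
pose D := (24 * C.+1)%N; pose M := (2 ^ 2 ^ s)%N; pose K := (s.+1 * (M * D ^ s))%N.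
pose t := (K + D + 4)%N.
have t_gt0 : (0 < t)%N by rewrite /t addnC.
pose p : rat := D%:R / t%:R.
have t_neq0 : t%:R != 0 :> rat by rewrite pnatr_eq0 -lt0n.
have p_ge0 : 0 <= p by rewrite divr_ge0.
have tp : t%:R * p = D%:R by rewrite /p mulrC divfK.
have p_le1 : p <= 1.
  by rewrite ler_pdivrMr ?ltr0n // mul1r ler_nat /t -addnA addnCA leq_addr.
pose A := [set e : {set 'I_t} | #|e| == 3%N].
have cardA : #|A| = 'C(t, 3) by rewrite card_draws card_ord.
(* The condition [2 < v] makes the system of [v - 1] sets nonempty, as [deletion_method]
   requires. *)
pose P (k : 'I_s.+1 * {set 'I_t} * {set {set 'I_t}}) :=
  [&& (2 < k.1.1)%N, #|k.1.2| == k.1.1, k.2 \subset powerset k.1.2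
    & #|k.2| == k.1.1.-1].
have P_neq0 k : P k -> k.2 != set0.
  case/and4P => k3 _ _ /eqP card_k; rewrite -card_gt0 card_k.
  by case: (k.1.1 : nat) k3 => [|[]].
have [S [SA Sfree leS]] := deletion_method A p_ge0 p_le1 P_neq0.
have le_bad : \sum_(k | P k) p ^+ #|k.2| <= (K * t)%:R.
  rewrite big_mkcond -(pair_bigA _ (fun vU T =>
    if P (vU, T) then p ^+ #|T| else 0)) /=.
  rewrite -(pair_bigA _ (fun v U =>
    \sum_T if P ((v, U), T) then p ^+ #|T| else 0)) /=.
  have le_v (v : 'I_s.+1) : \sum_U \sum_T (if P ((v, U), T) then p ^+ #|T| else 0)
      <= (M * D ^ s * t)%:R.
    have [v3|v3] := ltnP 2 v; last first.
      by rewrite big1 // => U _; rewrite big1 // => T _; rewrite /P /= ltnNge v3.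
    have leT (U : {set 'I_t}) : \sum_T (if P ((v, U), T) then p ^+ #|T| else 0)
        <= (if #|U| == v then M%:R * p ^+ v.-1 else 0).
      rewrite /P /= v3 /=; case: eqP => [Uv|_]; last by rewrite big1.
      rewrite -big_mkcond /=.
      rewrite (eq_bigr (fun=> p ^+ v.-1)) => [|T /andP[_ /eqP ->] //].
      rewrite sumr_const -[leLHS]mulr_natl ler_wpM2r ?exprn_ge0 // ler_nat.
      apply: (@leq_trans #|powerset (powerset U)|).
        by apply: subset_leq_card; apply/subsetP => T; rewrite unfold_in /= inE => /andP[].
      rewrite !card_powerset Uv leq_pexp2l // leq_pexp2l //.
      by rewrite -ltnS.
    apply: (le_trans (ler_sum _ (fun U _ => leT U))).
    rewrite -big_mkcond /= sumr_const -[X in _ *+ X](_ : 'C(t, v) = _); last first.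
      rewrite -[t in LHS]card_ord -card_draws.
      by apply: eq_card => U; rewrite inE.
    have v_gt0 : (0 < v)%N by apply: leq_trans v3.
    rewrite -[leLHS]mulr_natr -mulrA mulnAC -mulnA natrM ler_wpM2l //.
    apply: (@le_trans _ _ (p ^+ v.-1 * (t ^ v)%:R)).
      by rewrite ler_wpM2l ?exprn_ge0 // ler_nat leq_bin_expn.
    rewrite -(prednK v_gt0) /= expnS natrM natrX mulrCA -exprMn [p * _]mulrC tp.
    rewrite -natrX -natrM ler_nat leq_mul2l leq_pexp2l ?orbT //.
    by rewrite (leq_trans (leq_pred v)) // -ltnS.
  apply: (le_trans (ler_sum _ (fun v _ => le_v v))).
  by rewrite sumr_const card_ord -[leLHS]mulr_natl -natrM ler_nat /K !mulnA.
exists t, S; split => //.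
- by apply/forall_inP => e /(subsetP SA); rewrite inE.
- move=> U Us; rewrite leqNgt; apply/negP => ltU.
  (* The truncated bound [#|U| - 2] is 0 for small [U], but an edge inside [U] forces three
     vertices; exceeding the bound then means at least [#|U| - 1] edges, a forbidden
     configuration. *)
  have U3 : (2 < #|U|)%N.
    have [e] : exists e, e \in [set e in S | e \subset U].
      by apply/set0Pn; rewrite -card_gt0 (leq_ltn_trans _ ltU).
    rewrite inE => /andP[/(subsetP SA) + /subset_leq_card].
    by rewrite inE => /eqP ->.
  have [T] : exists T, T \in [set T : {set {set 'I_t}} |
      T \subset [set e in S | e \subset U] & #|T| == #|U|.-1].
    apply/set0Pn; rewrite -card_gt0 cards_draws bin_gt0.
    by case: #|U| U3 ltU => [|[|u]] // _; rewrite subSS subSS subn0.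
  rewrite inE => /andP[TS cT].
  have Us' : (#|U| < s.+1)%N by rewrite ltnS.
  have PT : P ((Ordinal Us', U), T).
    rewrite /P /= U3 eqxx cT andbT; apply/subsetP => e /(subsetP TS).
    by rewrite !inE => /andP[].
  have /negP[] := Sfree _ PT.
  by apply/subsetP => e /(subsetP TS); rewrite inE => /andP[].
rewrite -(ler_nat rat); apply: le_trans leS; rewrite cardA.
have C6 := bin3_natr rat t.
have t4 : 4 <= t%:R :> rat by rewrite ler_nat /t leq_addl.
have tK : K%:R <= t%:R :> rat by rewrite ler_nat /t -addnA leq_addr.
have -> : p * 'C(t, 3)%:R = D%:R * (t%:R - 1) * (t%:R - 2) / 6.
  by rewrite -[_%:R](mulfK (_ : 6 != 0 :> rat)) // C6 -tp; field.
rewrite lerBrDr; apply: le_trans (lerD (lexx _) le_bad) _.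
have -> : (C * t ^ 2)%:R = C%:R * t%:R ^+ 2 :> rat by rewrite natrM natrX.
have -> : (K * t)%:R = K%:R * t%:R :> rat by exact: natrM.
have -> : D%:R = 24 * (C%:R + 1) :> rat by rewrite natr1 -natrM.
have C0 : 0 <= C%:R :> rat by [].
have tt : t%:R ^+ 2 <= 4 * ((t%:R - 1) * (t%:R - 2)) :> rat by nra.
have Kt : K%:R * t%:R <= t%:R ^+ 2 :> rat by rewrite expr2 ler_wpM2r.
have Ct : (C%:R + 1) * t%:R ^+ 2 <=
    (C%:R + 1) * (4 * ((t%:R - 1) * (t%:R - 2))) :> rat.
  by rewrite ler_wpM2l // addr_ge0.
lra.
Qed.

(** * Lagrangians *)

(* Summing over ordered triples counts each edge six times. *)
Definition lagrange (R : realFieldType) (V : finType) (E : {set {set V}})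
    (w : V -> R) : R :=
  \sum_a \sum_b \sum_c ([set a; b; c] \in E)%:R * (w a * w b * w c).

Definition power_sum (R : realFieldType) (I : finType) (k : nat) (y : I -> R) : R :=
  \sum_i y i ^+ k.

Section DistinctTriples.
Variables (R : realFieldType) (I : finType) (y : I -> R).

Lemma sum_pred1_l (G : I -> R) (i : I) : \sum_j (i == j)%:R * G j = G i.
Proof.
rewrite (bigD1 i) //= eqxx mul1r big1 ?addr0 // => j.
by rewrite eq_sym => /negPf ->; rewrite mul0r.
Qed.

Lemma sum_distinct_pairs :
  \sum_i \sum_j (i != j)%:R * (y i * y j) = power_sum 1 y ^+ 2 - power_sum 2 y.
Proof.
have E i : \sum_j (i != j)%:R * (y i * y j) = y i * power_sum 1 y - y i ^+ 2.
  rewrite /power_sum mulr_sumr.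
  rewrite expr2 -(sum_pred1_l (fun j => y i * y j) i) -sumrB.
  by apply: eq_bigr => j _; have [<-|_] := eqVneq i j; rewrite /= ?expr1; ring.
under eq_bigr do rewrite E.
by rewrite sumrB -mulr_suml {1 2}/power_sum expr2; under [X in X * _]eq_bigr do rewrite -[y _]expr1.
Qed.

(** Newton's identity for six times the third elementary symmetric polynomial, obtained by removing
    coincidences one index at a time. *)
Lemma sum_distinct_triples :
  \sum_i \sum_j \sum_k (uniq [:: i; j; k])%:R * (y i * y j * y k) =
  power_sum 1 y ^+ 3 - 3 * power_sum 1 y * power_sum 2 y + 2 * power_sum 3 y.
Proof.
set P1 := power_sum 1 y; set P2 := power_sum 2 y.
have S1 : \sum_k y k = P1 by apply: eq_bigr => k _; rewrite expr1.
have Ek i j : \sum_k (uniq [:: i; j; k])%:R * (y i * y j * y k) =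
    (i != j)%:R * (y i * y j) * (P1 - y i - y j).
  transitivity ((i != j)%:R * (y i * y j) *
      \sum_k (y k - (i == k)%:R * y k - (j == k)%:R * y k)).
    rewrite mulr_sumr; apply: eq_bigr => k _; rewrite /= !inE !andbT negb_or.
    case: (eqVneq i j) => [->|ij] /=; first by rewrite !mul0r.
    case: (eqVneq i k) => [<-|ik] /=.
      by rewrite [j == i]eq_sym (negPf ij) /=; ring.
    by case: (eqVneq j k) => [<-|jk] /=; ring.
  by rewrite !sumrB S1 !(sum_pred1_l y).
under eq_bigr => i _ do under eq_bigr => j _ do rewrite Ek.
have Ej i : \sum_j (i != j)%:R * (y i * y j) * (P1 - y i - y j) =
    y i * P1 ^+ 2 - y i ^+ 2 * P1 - y i * P2 - P1 * y i ^+ 2 + 2 * y i ^+ 3.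
  transitivity (\sum_j ((y i * P1 - y i ^+ 2) * y j - y i * y j ^+ 2 -
      (i == j)%:R * (P1 * (y i * y j) - y i ^+ 2 * y j - y i * y j ^+ 2))).
    by apply: eq_bigr => j _; have [<-|_] := eqVneq i j; rewrite /=; ring.
  rewrite !sumrB -!mulr_sumr S1 -/P2 -/(power_sum 2 y) -/P2.
  by rewrite (sum_pred1_l (fun j => P1 * (y i * y j) - y i ^+ 2 * y j - y i * y j ^+ 2)); ring.
under eq_bigr do rewrite Ej.
rewrite big_split /= !sumrB -!mulr_suml -!mulr_sumr S1 -/P2 -/(power_sum 2 y) -/P2.
by rewrite -/(power_sum 3 y); ring.
Qed.

(* Multiplying Cauchy-Schwarz on the indices other than [i] by [y i], and the
   tangent line of [u * (x - u) ^ 2] at [u = x / n], are added up. *)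
Lemma distinct_triples_le : (forall i, 0 <= y i) ->
  #|I|%:R ^+ 2 * \sum_i \sum_j \sum_k (uniq [:: i; j; k])%:R * (y i * y j * y k)
  <= (#|I|%:R - 1) * (#|I|%:R - 2) * (\sum_i y i) ^+ 3.
Proof.
move=> y_ge0; have [I1|I2] := leqP #|I| 1.
  rewrite [X in _ * X]big1 => [|i _].
    have /orP[/eqP ->|/eqP ->] : (#|I| == 0%N) || (#|I| == 1%N).
    - by case: #|I| I1 => [|[]].
    - by rewrite mulr0 mulr_ge0 ?exprn_ge0 ?sumr_ge0 //; lra.
    - by rewrite subrr !mul0r mulr0.
  rewrite big1 // => j _; rewrite big1 // => k _.
  by rewrite /= inE (fintype_le1P I1 i j) eqxx mul0r.
rewrite sum_distinct_triples.
have S1 : \sum_k y k = power_sum 1 y by apply: eq_bigr => k _; rewrite expr1.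
rewrite S1; set x := power_sum 1 y in S1 *.
set P2 := power_sum 2 y; set P3 := power_sum 3 y; set n := #|I|%:R : R.
have y_le i : y i <= x by rewrite -S1 (bigD1 i) //= lerDl sumr_ge0.
have x_ge0 : 0 <= x by rewrite -S1 sumr_ge0.
have n2 : 2 <= n by rewrite ler_nat.
have Sc (c : R) : \sum_(j : I) c = n * c by rewrite sumr_const mulr_natl.
have cauchy_i i : 0 <= (n - 1) * (P2 - y i ^+ 2) - (x - y i) ^+ 2.
  have n1 : 0 < n - 1 by lra.
  rewrite -(pmulr_rge0 _ n1).
  suff <- : \sum_j ((n - 1) * y j - (x - y i)) ^+ 2 * (i != j)%:R =
      (n - 1) * ((n - 1) * (P2 - y i ^+ 2) - (x - y i) ^+ 2).
    by apply: sumr_ge0 => j _; rewrite mulr_ge0 ?sqr_ge0.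
  transitivity (\sum_j ((n - 1) ^+ 2 * y j ^+ 2 - 2 * (n - 1) * (x - y i) * y j
      + (x - y i) ^+ 2 - (i == j)%:R * ((n - 1) * y j - (x - y i)) ^+ 2)).
    by apply: eq_bigr => j _; have [<-|_] := eqVneq i j; rewrite /=; ring.
  rewrite sumrB big_split sumrB /= -!mulr_sumr S1 Sc -/(power_sum 2 y) -/P2.
  by rewrite (sum_pred1_l (fun j => ((n - 1) * y j - (x - y i)) ^+ 2)); ring.
have cauchy : 0 <= (n + 1) * x * P2 - n * P3 - x ^+ 3.
  suff -> : (n + 1) * x * P2 - n * P3 - x ^+ 3 =
      \sum_i y i * ((n - 1) * (P2 - y i ^+ 2) - (x - y i) ^+ 2).
    by apply: sumr_ge0 => i _; rewrite mulr_ge0.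
  transitivity (\sum_i (((n - 1) * P2 - x ^+ 2) * y i + 2 * x * y i ^+ 2
      - n * y i ^+ 3)); last by apply: eq_bigr => i _; ring.
  rewrite sumrB big_split /= -!mulr_sumr S1 -/(power_sum 2 y) -/(power_sum 3 y).
  by rewrite -/P2 -/P3; ring.
(* The cubic minus its tangent has a double root at [x / n]; its third root [2 * x - 2 * (x / n)] is
   at least [x >= y i] because [n >= 2]. *)
have tangent : 0 <= 2 * n ^+ 2 * x * P2 - n ^+ 2 * P3 - (2 * n - 1) * x ^+ 3.
  suff -> : 2 * n ^+ 2 * x * P2 - n ^+ 2 * P3 - (2 * n - 1) * x ^+ 3 =
      \sum_i (n * y i - x) ^+ 2 * (2 * x - 2 * (x / n) - y i).
    apply: sumr_ge0 => i _; rewrite mulr_ge0 ?sqr_ge0 //.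
    have : x / n <= x / 2 by rewrite ler_pM // ?invr_ge0 ?lef_pV2 ?posrE; lra.
    by have := y_le i; lra.
  pose c := 2 * x ^+ 3 - 2 * x ^+ 3 / n.
  transitivity (\sum_i ((2 * n ^+ 2 * x) * y i ^+ 2 - n ^+ 2 * y i ^+ 3
      - (4 * n - 3) * x ^+ 2 * y i + c)).
    rewrite big_split /= Sc !sumrB -!mulr_sumr S1.
    by rewrite -/(power_sum 2 y) -/(power_sum 3 y) -/P2 -/P3 /c; field; lra.
  by apply: eq_bigr => i _; rewrite /c; field; lra.
have n1 : 0 < n - 1 by lra.
rewrite -subr_ge0 -(pmulr_rge0 _ n1).
have -> : (n - 1) * ((n - 1) * (n - 2) * x ^+ 3 -
    n ^+ 2 * (x ^+ 3 - 3 * x * P2 + 2 * P3)) =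
  n ^+ 2 * ((n + 1) * x * P2 - n * P3 - x ^+ 3) +
  (n - 2) * (2 * n ^+ 2 * x * P2 - n ^+ 2 * P3 - (2 * n - 1) * x ^+ 3) by ring.
by rewrite addr_ge0 // mulr_ge0 ?sqr_ge0 // subr_ge0.
Qed.
End DistinctTriples.

Lemma card_set3 (V : finType) (a b c : V) :
  (#|[set a; b; c]| == 3%N) = uniq [:: a; b; c].
Proof.
have -> : #|[set a; b; c]| = #|[:: a; b; c]|.
  by apply: eq_card => x; rewrite !inE orbA.
exact/eqP/card_uniqP.
Qed.

Lemma card_orderings3 (V : finType) (e : {set V}) : #|e| = 3%N ->
  (\sum_a \sum_b \sum_c ([set a; b; c] == e))%N = 6.
Proof.
move=> e3.
have E a b c : ([set a; b; c] == e) =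
    [&& a \in e, b \in e :\ a & c \in e :\ a :\ b].
  apply/eqP/and3P => [abc|[ae]].
    have : uniq [:: a; b; c] by rewrite -card_set3 abc e3.
    rewrite /= !inE andbT negb_or -abc !inE !eqxx !orbT /= => /andP[/andP[ab ac] bc].
    by rewrite [b == a]eq_sym ab [c == b]eq_sym bc [c == a]eq_sym ac.
  rewrite !inE => /andP[ba be] /and3P[cb ca ce].
  apply/eqP; rewrite eqEcard; apply/andP; split.
    by apply/subsetP => x; rewrite !inE -orbA => /or3P[]/eqP->.
  rewrite e3 eq_leq //; apply/esym/eqP; rewrite card_set3 /= !inE !negb_or.
  by rewrite [a == b]eq_sym ba [a == c]eq_sym ca [b == c]eq_sym cb.
transitivity (\sum_(a in e) \sum_(b in e :\ a) \sum_(c in e :\ a :\ b) 1)%N.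
  rewrite [RHS]big_mkcond; apply: eq_bigr => a _.
  case: ifP => ae; last by rewrite big1 // => b _; rewrite big1 // => c _; rewrite E ae.
  rewrite [RHS]big_mkcond; apply: eq_bigr => b _.
  case: ifP => be; last by rewrite big1 // => c _; rewrite E be andbF.
  by rewrite [RHS]big_mkcond; apply: eq_bigr => c _; rewrite E ae be; case: ifP.
transitivity (\sum_(a in e) \sum_(b in e :\ a) 1)%N.
  apply: eq_bigr => a ae; apply: eq_bigr => b be; rewrite sum1_card.
  by have := cardsD1 a e; have := cardsD1 b (e :\ a); rewrite ae be e3; lia.
transitivity (\sum_(a in e) 2)%N.
  apply: eq_bigr => a ae; rewrite sum1_card.
  by have := cardsD1 a e; rewrite ae e3; lia.
by rewrite sum_nat_const e3.
Qed.

Lemma sum_triples_edges (R : realFieldType) (V : finType) (E : {set {set V}})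
    (F : {set V} -> R) : uniform 3 E ->
  \sum_a \sum_b \sum_c ([set a; b; c] \in E)%:R * F [set a; b; c] =
  6 * \sum_(e in E) F e.
Proof.
move=> uE.
have E1 a b c : ([set a; b; c] \in E)%:R * F [set a; b; c] =
    \sum_(e in E) ([set a; b; c] == e)%:R * F e.
  have [abcE|abcE] := boolP (_ \in E).
    rewrite (bigD1 [set a; b; c]) //= eqxx big1 ?addr0 // => e /andP[_].
    by rewrite eq_sym => /negPf ->; rewrite mul0r.
  rewrite mul0r big1 // => e eE; case: eqP abcE => [->|]; first by rewrite eE.
  by rewrite mul0r.
under eq_bigr => a _ do under eq_bigr => b _ do
  (under eq_bigr => c _ do rewrite E1; rewrite exchange_big).
under eq_bigr => a _ do rewrite exchange_big.
rewrite exchange_big mulr_sumr; apply: eq_bigr => e eE.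
have <- : (\sum_a \sum_b \sum_c ([set a; b; c] == e))%N%:R = 6 :> R.
  by rewrite card_orderings3 //; apply/eqP/(forall_inP uE).
rewrite natr_sum mulr_suml; apply: eq_bigr => a _.
rewrite natr_sum mulr_suml; apply: eq_bigr => b _.
by rewrite natr_sum mulr_suml; apply: eq_bigr.
Qed.

Lemma lagrange_edges (R : realFieldType) (V : finType) (E : {set {set V}})
    (w : V -> R) : uniform 3 E ->
  lagrange E w = 6 * \sum_(e in E) \prod_(i in e) w i.
Proof.
move=> uE; rewrite -sum_triples_edges //.
apply: eq_bigr => a _; apply: eq_bigr => b _; apply: eq_bigr => c _.
have [abcE|_] := boolP (_ \in E); last by rewrite !mul0r.
have : uniq [:: a; b; c] by rewrite -card_set3; apply: (forall_inP uE).
rewrite /= !inE negb_or andbT => /andP[/andP[ab ac] bc]; congr (_ * _).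
rewrite -setUA !big_setU1 ?big_set1 ?inE ?(negPf ab) ?(negPf ac) //=.
by rewrite mulrA.
Qed.

(* Subtracting the least weight on [X] from all weights and all [m e] reduces
   the claim to [X] minus a point, edges through that point becoming negligible. *)
Lemma sum_sparse_le (R : realFieldType) (V : finType) (S : {set {set V}})
    (Q X : {set V}) (w : V -> R) (m : {set V} -> R) :
  (forall Y : {set V}, Y \subset X ->
     (#|[set e in S | e \subset Q :|: Y]| <= #|Y|)%N) ->
  (forall i, i \in X -> 0 <= w i) ->
  (forall e i, e \in S -> i \in e -> i \in X -> m e <= w i) ->
  \sum_(e in S | e \subset Q :|: X) m e <= \sum_(i in X) w i.
Proof.
have [k] := ubnP #|X|; elim: k X w m => // k IH X w m.
rewrite ltnS => Xk sparse w_ge0 le_m.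
have [X0|/set0Pn[i0 i0X]] := eqVneq X set0.
  have := sparse X (subxx _); rewrite [in X in (_ <= X)%N]X0 cards0 leqn0 cards_eq0.
  move=> /eqP S0; rewrite big_pred0 ?sumr_ge0 // => e.
  by apply/negbTE/negP => eS; have := in_set0 e; rewrite -S0 inE eS.
have [z zX le_z] := arg_minP w i0X.
have {}zX : z \in X by [].
have card_X := cardsD1 z X; rewrite zX in card_X.
have {IH} := IH (X :\ z) (fun i => w i - w z) (fun e => m e - w z).
have sub_X : X :\ z \subset X by exact: subsetDl.
have lt_k : (#|X :\ z| < k)%N by move: Xk; rewrite card_X.
move=> /(_ lt_k) IH.
have {}IH : \sum_(e in S | e \subset Q :|: X :\ z) (m e - w z) <=
    \sum_(i in X :\ z) (w i - w z).
  apply: IH => [Y YX|i|e i eS ie].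
  - by apply: sparse; apply: subset_trans YX _.
  - by rewrite inE => /andP[_ iX]; rewrite subr_ge0 le_z.
  - by rewrite inE => /andP[_ iX]; rewrite lerB // le_m.
have le_sum : \sum_(e in S | e \subset Q :|: X) (m e - w z) <=
    \sum_(e in S | e \subset Q :|: X :\ z) (m e - w z).
  rewrite big_mkcondr [leRHS]big_mkcondr; apply: ler_sum => e eS.
  have [sub|sub] := boolP (e \subset Q :|: X :\ z).
    by rewrite (subset_trans sub) // setUS.
  case: ifP => // /subsetP eQX; rewrite subr_le0.
  suff ze : z \in e by rewrite le_m.
  case/subsetPn: sub => x xe; move: (eQX x xe); rewrite !inE.
  by case: eqP => [<-|_]; rewrite ?xe //= => ->.
(* Undoing the shift costs [w z] per edge on the left and yields [w z] per point of [X] on the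
   right; sparsity with [Y = X] compares the two counts. *)
have sum_m : \sum_(e in S | e \subset Q :|: X) m e =
    \sum_(e in S | e \subset Q :|: X) (m e - w z) +
    w z * #|[set e in S | e \subset Q :|: X]|%:R.
  rewrite sumrB sumr_const mulr_natr -[X in _ - X](_ : w z *+ #|[set e in S | e \subset Q :|: X]| = _); last first.
    by congr (_ *+ _); rewrite cardsE.
  by rewrite subrK.
have sum_w : \sum_(i in X) w i = \sum_(i in X :\ z) (w i - w z) + w z * #|X|%:R.
  rewrite (big_setD1 z) //= sumrB sumr_const card_X mulr_natr add1n mulrS.
  by rewrite addrCA subrK addrC.
rewrite sum_m sum_w lerD ?(le_trans le_sum) // ler_wpM2l ?w_ge0 // ler_nat.
exact: sparse.
Qed.

(** At most one of the two vertices of [e] other than [i] is [i1], so one of their weights is at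
    most [w i1] and the other at most [w i2]. *)
Lemma prod_set_le (R : realFieldType) (V : finType) (w : V -> R) (i1 i2 i : V)
    (e : {set V}) :
  (forall j, 0 <= w j) -> (forall j, w j <= w i1) ->
  (forall j, j != i1 -> w j <= w i2) -> #|e| = 3%N -> i \in e ->
  \prod_(j in e) w j <= w i * (w i1 * w i2).
Proof.
move=> w_ge0 le1 le2 e3 ie.
have /eqP/cards2P[j [k [jk ejk]]] : #|e :\ i| = 2%N.
  by have := cardsD1 i e; rewrite ie e3; lia.
rewrite (big_setD1 i) //= ejk big_setU1 ?inE //= big_set1 ler_wpM2l //.
have [ji|ji] := eqVneq j i1; last by rewrite mulrC ler_pM ?le2.
by rewrite ler_pM ?le2 // -ji eq_sym.
Qed.

(** Take for [a] and [b] the two largest weights. By [prod_set_le], an edge product divided by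
    [a * b] is at most each of its vertex weights, so [sum_sparse_le] bounds the sum of these
    quotients by the remaining weight. The [- 2] in the sparsity pays for the pair [Q]. *)
Lemma lagrange_sparse_le (R : realFieldType) (V : finType) (S : {set {set V}})
    (s : nat) (w : V -> R) :
  uniform 3 S ->
  (forall U : {set V}, (#|U| <= s)%N ->
     (#|[set e in S | e \subset U]| <= #|U| - 2)%N) ->
  (forall i, 0 <= w i) -> (#|[set i | w i != 0%R]| <= s)%N ->
  exists a b : R, [/\ 0 <= a, 0 <= b, a + b <= \sum_i w i,
    a ^+ 2 + b ^+ 2 <= power_sum 2 w
    & lagrange S w <= 6 * a * b * (\sum_i w i - a - b)].
Proof.
move=> uS sparse w_ge0; set U := [set i | w i != 0] => Us.
rewrite (lagrange_edges _ uS).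
have prod0 (e : {set V}) : ~~ (e \subset U) -> \prod_(i in e) w i = 0.
  case/subsetPn => i ie; rewrite inE negbK => /eqP wi.
  by rewrite (bigD1 i) //= wi mul0r.
have [e /andP[eS eU]|noE] := pickP [pred e in S | e \subset U]; last first.
  exists 0, 0; rewrite !addr0 expr0n addr0 mulr0 mul0r sumr_ge0 //.
  rewrite sumr_ge0 => [|i _]; last by rewrite exprn_ge0.
  split=> //; rewrite big1 ?mulr0 // => e eS; apply: prod0.
  by have := noE e; rewrite inE /= eS => /negbT.
have e3 : #|e| = 3%N by apply/eqP/(forall_inP uS).
have U3 : (2 < #|U|)%N by rewrite -e3 subset_leq_card.
have [i0 i0U] : exists i, i \in U by apply/set0Pn; rewrite -card_gt0; lia.
have [i1 _ le1] := arg_maxP w (isT : xpredT i0).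
have [i0' i0'U] : exists i, i \in U :\ i1.
  by apply/set0Pn; rewrite -card_gt0; have := cardsD1 i1 U; lia.
have i0'1 : i0' != i1 by move: i0'U; rewrite !inE => /andP[].
have [i2 i21 le2] := arg_maxP (P := fun i => i != i1) w i0'1.
have w1 : 0 < w i1.
  by rewrite (lt_le_trans _ (le1 i0 isT)) // lt0r w_ge0 andbT; rewrite inE in i0U.
have w2 : 0 < w i2.
  rewrite (lt_le_trans _ (le2 _ i0'1)) // lt0r w_ge0 andbT.
  by move: i0'U; rewrite !inE => /andP[].
have i12 : i1 != i2 by rewrite eq_sym.
pose Q := [set i1; i2]; pose X := U :\: Q.
have QU : Q \subset U.
  by apply/subsetP => i; rewrite !inE => /orP[]/eqP->; rewrite gt_eqF.
have sumQ (F : V -> R) : \sum_(i in Q) F i = F i1 + F i2.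
  by rewrite big_setU1 ?inE //= big_set1.
have sumX : \sum_(i in X) w i = \sum_i w i - w i1 - w i2.
  have -> : \sum_i w i = \sum_(i in U) w i.
    rewrite [RHS]big_mkcond; apply: eq_bigr => i _; case: ifP => //.
    by rewrite inE => /negbFE/eqP.
  rewrite [X in _ = X - _ - _](big_setID Q) /= (setIidPr QU) sumQ -/X; lra.
have X_ge0 : 0 <= \sum_(i in X) w i by rewrite sumr_ge0.
exists (w i1), (w i2); rewrite !w_ge0; split=> //.
- by move: X_ge0; rewrite sumX; lra.
- rewrite /power_sum (bigD1 i1) //= (bigD1 i2) //= addrA lerDl sumr_ge0 // => i _.
  by rewrite exprn_ge0.
rewrite -!mulrA ler_pM2l //.
have le_edges : \sum_(e in S | e \subset Q :|: X) (\prod_(i in e) w i) / (w i1 * w i2)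
    <= \sum_(i in X) w i.
  apply: sum_sparse_le => // [Y YX|f i fS i_f _].
    have cQ : #|Q| = 2%N by rewrite cards2 i12.
    have QY : Q :|: Y \subset U.
      by rewrite subUset QU (subset_trans YX) // subsetDl.
    apply: (leq_trans (sparse _ (leq_trans (subset_leq_card QY) Us))).
    by have := (leq_card_setU Q Y).1; rewrite cQ; lia.
  rewrite ler_pdivrMr ?mulr_gt0 // prod_set_le //.
  - by move=> j; apply: le1.
  - exact/eqP/(forall_inP uS).
have QX : Q :|: X = U by rewrite -{1}(setIidPr QU) setID.
move: le_edges; rewrite sumX QX -mulr_suml ler_pdivrMr ?mulr_gt0 //.
have -> : \sum_(e in S) \prod_(i in e) w i =
    \sum_(e in S | e \subset U) \prod_(i in e) w i.
  rewrite [RHS]big_mkcondr; apply: eq_bigr => f _.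
  by case: ifP => // /negbT; apply: prod0.
by rewrite mulrC mulrA.
Qed.

(** * The pattern *)

(* [inl i] is the part V_i, and [inr i] is the i-th vertex of W. *)
Definition pattern (n t : nat) (S : {set {set 'I_t}}) (j1 j2 j3 : 'I_n + 'I_t) :=
  match j1, j2, j3 with
  | inl i, inl j, inl k => uniq [:: i; j; k]
  | inl _, inl _, inr _ | inl _, inr _, inl _ | inr _, inl _, inl _ => true
  | inl _, inr i, inr j | inr i, inl _, inr j | inr i, inr j, inl _ => i != j
  | inr i, inr j, inr k => [set i; j; k] \in S
  end.

Definition pattern_poly (R : realFieldType) (n t : nat) (S : {set {set 'I_t}})
    (y : 'I_n + 'I_t -> R) : R :=
  \sum_j1 \sum_j2 \sum_j3 y j1 * y j2 * y j3 * (pattern S j1 j2 j3)%:R.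

Section PatternPolynomial.
Variables (R : realFieldType) (n t : nat) (S : {set {set 'I_t}}).
Variable y : 'I_n + 'I_t -> R.

Lemma pattern_polyE :
  let yv i := y (inl i) in let yw i := y (inr i) in
  let x := \sum_i yv i in let w := \sum_i yw i in
  pattern_poly S y =
    \sum_i \sum_j \sum_k (uniq [:: i; j; k])%:R * (yv i * yv j * yv k)
    + 3 * x ^+ 2 * w + 3 * x * (w ^+ 2 - power_sum 2 yw) + lagrange S yw.
Proof.
move=> yv yw x w; rewrite /pattern_poly big_sumType /=.
have Sx : \sum_i yv i = x by [].
have Sw : \sum_i yw i = w by [].
have pairs : \sum_i \sum_j (i != j)%:R * (yw i * yw j) = w ^+ 2 - power_sum 2 yw.
  by rewrite sum_distinct_pairs {1}/power_sum; under eq_bigr do rewrite expr1.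
have -> : \sum_i \sum_j2 \sum_j3
      y (inl i) * y j2 * y j3 * (pattern S (inl i) j2 j3)%:R =
    \sum_i (\sum_j \sum_k (uniq [:: i; j; k])%:R * (yv i * yv j * yv k)
      + yv i * (2 * x * w + (w ^+ 2 - power_sum 2 yw))).
  apply: eq_bigr => i _; rewrite big_sumType /=.
  under eq_bigr do rewrite big_sumType /=.
  rewrite big_split /= -addrA; congr (_ + _).
    by apply: eq_bigr => j _; apply: eq_bigr => k _; rewrite mulrC.
  transitivity (\sum_j yv i * w * yv j +
    \sum_j (yv i * x * yw j + yv i * \sum_k (j != k)%:R * (yw j * yw k))).
    congr (_ + _).
      apply: eq_bigr => j _; under eq_bigr do rewrite mulr1.
      by rewrite -mulr_sumr Sw -/(yv i) -/(yv j); ring.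
    apply: eq_bigr => j _; rewrite big_sumType /=; congr (_ + _).
      under eq_bigr do rewrite mulr1.
      by rewrite -mulr_sumr Sx -/(yv i) -/(yw j); ring.
    rewrite mulr_sumr; apply: eq_bigr => k _; rewrite -/(yv i) -/(yw j) -/(yw k); ring.
  by rewrite big_split /= -!mulr_sumr Sx Sw pairs; ring.
have -> : \sum_i \sum_j2 \sum_j3
      y (inr i) * y j2 * y j3 * (pattern S (inr i) j2 j3)%:R =
    \sum_i (yw i * x ^+ 2 + 2 * x * \sum_j (i != j)%:R * (yw i * yw j) +
      \sum_j \sum_k ([set i; j; k] \in S)%:R * (yw i * yw j * yw k)).
  apply: eq_bigr => i _; rewrite big_sumType /=.
  transitivity (\sum_j (yw i * x * yv j + yv j * \sum_k (i != k)%:R * (yw i * yw k))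
     + \sum_j (x * ((i != j)%:R * (yw i * yw j)) +
         \sum_k ([set i; j; k] \in S)%:R * (yw i * yw j * yw k))).
    congr (_ + _); apply: eq_bigr => j _; rewrite big_sumType /=; congr (_ + _).
    - under eq_bigr do rewrite mulr1.
      by rewrite -mulr_sumr Sx -/(yw i) -/(yv j); ring.
    - by rewrite mulr_sumr; apply: eq_bigr => k _; rewrite -/(yw i) -/(yv j) -/(yw k); ring.
    - by rewrite -mulr_suml -mulr_sumr Sx -/(yw i) -/(yw j); ring.
    - by apply: eq_bigr => k _; rewrite mulrC.
  by rewrite !big_split /= -mulr_sumr -mulr_suml -mulr_sumr Sx; ring.
rewrite !big_split /= -!mulr_suml -!mulr_sumr Sx Sw pairs /lagrange; ring.
Qed.
End PatternPolynomial.

(** The right-hand side is [(w - w0)^2] times a nonnegative factor. On the left, [2ab <= a^2 + b^2]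
    leaves [6ab (d - a - b)] with [d = w - x], which is positive only if [w > 1/2 >= w0]; then
    [w - w0 >= d / 2] makes the gap large enough. *)
Lemma cubic_gap (R : realFieldType) (w0 x w a b : R) :
  0 < w0 -> w0 <= 1 / 2 -> 0 <= x -> 0 <= w -> x + w = 1 ->
  0 <= a -> 0 <= b -> a + b <= w ->
  6 * a * b * (w - a - b) - 3 * x * (a ^+ 2 + b ^+ 2) <=
  w ^+ 3 + (w0 / (1 - w0)) ^+ 2 * x ^+ 3 - w0 ^+ 2.
Proof.
move=> w0_gt0 w0_le x_ge0 w_ge0 xw a_ge0 b_ge0 abw.
have w01 : 0 < 1 - w0 by lra.
have xE : x = 1 - w by lra.
have -> : w ^+ 3 + (w0 / (1 - w0)) ^+ 2 * x ^+ 3 - w0 ^+ 2 =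
    (w - w0) ^+ 2 * ((1 - 2 * w0) * w + w0 * (2 - w0)) / (1 - w0) ^+ 2.
  by rewrite xE; field; lra.
have q_ge0 : 0 <= (1 - 2 * w0) * w + w0 * (2 - w0).
  by rewrite addr_ge0 // mulr_ge0 //; lra.
have ab : 2 * (a * b) <= a ^+ 2 + b ^+ 2.
  by have := sqr_ge0 (a - b); rewrite sqrrB -mulr_natl; lra.
have ab_ge0 : 0 <= a * b by rewrite mulr_ge0.
apply: (@le_trans _ _ (6 * (a * b) * (w - x - (a + b)))).
  have := ler_wpM2l x_ge0 ab; lra.
have [wx|xw'] := leP w x.
  apply: (@le_trans _ _ 0).
    rewrite mulr_ge0_le0 //; first by rewrite mulr_ge0.
    by lra.
  by rewrite divr_ge0 ?sqr_ge0 // mulr_ge0 ?sqr_ge0.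
set d := w - x; have d_gt0 : 0 < d by rewrite subr_gt0.
have d_le1 : d <= 1 by rewrite /d; lra.
have wd : w = (1 + d) / 2 by rewrite /d; lra.
(* [2/9 d^3] is the maximum over [u = a + b] of [3/2 u^2 (d - u)], reached at [u = 2/3 d]; the
   factor [3/2] comes from [ab <= u^2 / 4]. *)
apply: (@le_trans _ _ (2 / 9 * d ^+ 3)).
  have [sd|ds] := leP (a + b) d; last first.
    apply: (@le_trans _ _ 0); last by rewrite mulr_ge0 ?exprn_ge0 ?ltW.
    rewrite mulr_ge0_le0 //; first by rewrite mulr_ge0.
    by lra.
  apply: (@le_trans _ _ (3 / 2 * (a + b) ^+ 2 * (d - (a + b)))).
    by rewrite ler_wpM2r ?subr_ge0 //; lra.
  set u := a + b in sd *.
  have u_ge0 : 0 <= u by rewrite addr_ge0.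
  rewrite -subr_ge0.
  have -> : 2 / 9 * d ^+ 3 - 3 / 2 * u ^+ 2 * (d - u) =
     (u - 2 / 3 * d) ^+ 2 * (3 / 2 * u + d / 2) by field.
  by rewrite mulr_ge0 ?sqr_ge0 //; lra.
rewrite ler_pdivlMr ?exprn_gt0 //.
have h1 : d ^+ 2 / 4 <= (w - w0) ^+ 2.
  have -> : d ^+ 2 / 4 = (d / 2) ^+ 2 by field.
  by rewrite ler_sqr ?nnegrE; lra.
have h2 : (1 + d) / 2 * (1 - w0) ^+ 2 <= (1 - 2 * w0) * w + w0 * (2 - w0).
  rewrite wd; nra.
(* After cancellation the first inequality is [2/9 d <= (1 + d) / 8], true for [d <= 1]. *)
apply: (@le_trans _ _ (d ^+ 2 / 4 * ((1 + d) / 2 * (1 - w0) ^+ 2))).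
  rewrite mulrA ler_wpM2r ?sqr_ge0 //.
  have -> : d ^+ 2 / 4 * ((1 + d) / 2) = d ^+ 2 * ((1 + d) / 8) by field.
  have -> : 2 / 9 * d ^+ 3 = d ^+ 2 * (2 / 9 * d) by ring.
  by rewrite ler_wpM2l ?sqr_ge0 //; lra.
by rewrite ler_pM ?mulr_ge0 ?sqr_ge0 ?divr_ge0 //; lra.
Qed.

(** * Blow-ups of the pattern *)

Section Blowup.
Variables (n t : nat) (S : {set {set 'I_t}}).

Lemma patternC12 (j1 j2 j3 : 'I_n + 'I_t) :
  pattern S j1 j2 j3 = pattern S j2 j1 j3.
Proof.
case: j1 j2 j3 => [i|i] [j|j] [k|k] //=; rewrite 1?eq_sym // ?inE.
- by rewrite [j == i]eq_sym; case: (i == j) (i == k) (j == k) => [] [] [].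
- by rewrite [[set i; j]]setUC.
Qed.

Lemma patternC23 (j1 j2 j3 : 'I_n + 'I_t) :
  pattern S j1 j2 j3 = pattern S j1 j3 j2.
Proof.
case: j1 j2 j3 => [i|i] [j|j] [k|k] //=; rewrite 1?eq_sym // ?inE.
- by rewrite [k == j]eq_sym; case: (i == j) (i == k) (j == k) => [] [] [].
- by rewrite setUAC.
Qed.

Variable V : finType.

Lemma pattern_set3 (phi : V -> 'I_n + 'I_t) (a b c a' b' c' : V) :
  uniq [:: a'; b'; c'] -> [set a; b; c] = [set a'; b'; c'] ->
  pattern S (phi a) (phi b) (phi c) = pattern S (phi a') (phi b') (phi c').
Proof.
rewrite /= !inE negb_or andbT => /andP[/andP[ab ac] bc] eq_abc.
have: a' \in [set a; b; c] by rewrite eq_abc !inE eqxx.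
have: b' \in [set a; b; c] by rewrite eq_abc !inE eqxx orbT.
have: c' \in [set a; b; c] by rewrite eq_abc !inE eqxx orbT.
rewrite !inE -!orbA => /or3P[]/eqP Ec /or3P[]/eqP Eb /or3P[]/eqP Ea;
  move: ab ac bc; rewrite Ea Eb Ec ?eqxx // => _ _ _;
  first [by [] | by rewrite patternC12 | by rewrite patternC23
    | by rewrite patternC12 patternC23 | by rewrite patternC23 patternC12
    | by rewrite patternC12 patternC23 patternC12].
Qed.

Definition blowup (phi : V -> 'I_n + 'I_t) : {set {set V}} :=
  [set e | [exists a, exists b, exists c, [&& uniq [:: a; b; c],
    e == [set a; b; c] & pattern S (phi a) (phi b) (phi c)]]].

Lemma in_blowup phi a b c : ([set a; b; c] \in blowup phi) =
  uniq [:: a; b; c] && pattern S (phi a) (phi b) (phi c).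
Proof.
rewrite inE; apply/existsP/andP => [[a' /existsP[b' /existsP[c']]]|[u p]].
  case/and3P=> u /eqP eq_abc p; split; last by rewrite (pattern_set3 _ u eq_abc).
  by rewrite -card_set3 eq_abc card_set3.
by exists a; apply/existsP; exists b; apply/existsP; exists c; rewrite u eqxx.
Qed.

Lemma blowup_uniform phi : uniform 3 (blowup phi).
Proof.
apply/forall_inP => e; rewrite inE => /existsP[a /existsP[b /existsP[c]]].
by case/and3P=> u /eqP -> _; rewrite card_set3.
Qed.

Variable R : realFieldType.

Lemma sum_pushforward (J : finType) (psi : V -> J) (w : V -> R) (G : J -> R) :
  \sum_j (\sum_(v | psi v == j) w v) * G j = \sum_v w v * G (psi v).
Proof.
rewrite [RHS](partition_big psi xpredT) //=; apply: eq_bigr => j _.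
by rewrite mulr_suml; apply: eq_bigr => v /eqP ->.
Qed.

(** Expanded over vertices, the right-hand side sums [w a * w b * w c] over all triples that [psi]
    maps into the pattern, and these include all triples forming an edge. *)
Lemma lagrange_le_pattern (E : {set {set V}}) (psi : V -> 'I_n + 'I_t)
    (w : V -> R) : (forall v, 0 <= w v) ->
  (forall a b c, [set a; b; c] \in E -> pattern S (psi a) (psi b) (psi c)) ->
  lagrange E w <= pattern_poly S (fun j => \sum_(v | psi v == j) w v).
Proof.
move=> w_ge0 Epsi; rewrite /pattern_poly.
under eq_bigr => j1 _ do under eq_bigr => j2 _ do
  under eq_bigr => j3 _ do rewrite -!mulrA.
under eq_bigr => j1 _ do under eq_bigr => j2 _ do
  rewrite -!mulr_sumr sum_pushforward.
under eq_bigr => j1 _ do rewrite -mulr_sumr sum_pushforward.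
rewrite sum_pushforward; apply: ler_sum => a _.
rewrite mulr_sumr; apply: ler_sum => b _.
rewrite !mulr_sumr; apply: ler_sum => c _.
have -> : w a * (w b * (w c * (pattern S (psi a) (psi b) (psi c))%:R)) =
    (pattern S (psi a) (psi b) (psi c))%:R * (w a * w b * w c) by ring.
rewrite ler_wpM2r ?mulr_ge0 //.
by have [/Epsi ->|] := boolP (_ \in E).
Qed.

(* Colouring the vertices independently according to [y], every triple is an
   edge with probability [pattern_poly S y]. *)
Lemma random_blowup (y : 'I_n + 'I_t -> R) :
  (forall j, 0 <= y j) -> \sum_j y j = 1 ->
  exists phi : V -> 'I_n + 'I_t,
    pattern_poly S y * 'C(#|V|, 3)%:R <= #|blowup phi|%:R.
Proof.
move=> y_ge0 y1.
suff [f] : exists f : {ffun V -> 'I_n + 'I_t},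
    pattern_poly S y * 'C(#|V|, 3)%:R <= #|blowup f|%:R by exists f.
apply: (first_moment y_ge0 y1).
have card6 (E : {set {set V}}) : uniform 3 E ->
    6 * #|E|%:R = \sum_a \sum_b \sum_c ([set a; b; c] \in E)%:R :> R.
  move=> uE; rewrite -[#|E|%:R]/(1 *+ #|E|) -sumr_const.
  rewrite -(sum_triples_edges (fun=> 1)) //.
  by do 3!apply: eq_bigr => ? _; rewrite mulr1.
rewrite -(@ler_pM2l _ 6) // mulr_sumr.
have -> : \sum_(f : {ffun V -> _}) 6 * (prodw y f * #|blowup f|%:R) =
    \sum_(a : V) \sum_b \sum_c (uniq [:: a; b; c])%:R * pattern_poly S y.
  transitivity (\sum_(f : {ffun V -> 'I_n + 'I_t}) \sum_a \sum_b \sum_c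
     (uniq [:: a; b; c])%:R * (prodw y f * (pattern S (f a) (f b) (f c))%:R)).
    apply: eq_bigr => f _; rewrite mulrCA card6 ?blowup_uniform // mulr_sumr.
    apply: eq_bigr => a _; rewrite mulr_sumr; apply: eq_bigr => b _.
    rewrite mulr_sumr; apply: eq_bigr => c _.
    by rewrite in_blowup -mulnb natrM mulrCA.
  rewrite exchange_big; apply: eq_bigr => a _.
  rewrite exchange_big; apply: eq_bigr => b _.
  rewrite exchange_big; apply: eq_bigr => c _.
  have [u|_] := boolP (uniq _); last by rewrite mul0r big1 // => f _; rewrite mul0r.
  rewrite -mulr_sumr; congr (_ * _).
  move: u; rewrite /= !inE negb_or andbT => /andP[/andP[ab ac] bc].
  exact: (sum_prodw3 y1 (fun j1 j2 j3 => (pattern S j1 j2 j3)%:R)).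
under eq_bigr => a _ do under eq_bigr => b _ do rewrite -mulr_suml.
under eq_bigr => a _ do rewrite -mulr_suml.
rewrite -mulr_suml mulrCA mulrC ler_wpM2r //.
  by do 3!(apply: sumr_ge0 => ? _); rewrite mulr_ge0 // !mulr_ge0.
rewrite -card_draws card6.
  apply: ler_sum => a _; apply: ler_sum => b _; apply: ler_sum => c _.
  by rewrite inE card_set3.
by apply/forall_inP => e; rewrite inE.
Qed.
End Blowup.

(** * Upper and lower bounds for the pattern polynomial *)

Section PatternBounds.
Variables (R : realFieldType) (n t s : nat) (S : {set {set 'I_t}}) (w0 : R).
Hypotheses (n_gt0 : (0 < n)%N) (w0_gt0 : 0 < w0) (w0_le : w0 <= 1 / 2).
(** For [w0 = k / (n + k)] the ratio [w0 / (1 - w0)] is [k / n], so this is [k^2 = 3n - 2]. It turns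
    [n^2 - k^2] into [(n - 1) (n - 2)], the coefficient in [distinct_triples_le]. *)
Hypothesis w0n : (w0 / (1 - w0)) ^+ 2 * n%:R ^+ 2 = 3 * n%:R - 2.
Hypothesis uS : uniform 3 S.

(** Subtracting the polynomial from [(x + w)^3 = 1] leaves at least [w^3 + (k/n)^2 x^3 + 3 x p2]
    minus the Lagrangian of [S]; [lagrange_sparse_le] and [cubic_gap] show that this is at least
    [w0^2]. *)
Lemma pattern_poly_le (y : 'I_n + 'I_t -> R) :
  (forall U : {set 'I_t}, (#|U| <= s)%N ->
     (#|[set e in S | e \subset U]| <= #|U| - 2)%N) ->
  (forall j, 0 <= y j) -> \sum_j y j = 1 ->
  (#|[set i : 'I_t | y (inr i) != 0%R]| <= s)%N ->
  pattern_poly S y <= 1 - w0 ^+ 2.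
Proof.
move=> sparse y_ge0; rewrite big_sumType /= => xw supp.
have := @lagrange_sparse_le R _ S s (fun i => y (inr i)) uS sparse
  (fun i => y_ge0 (inr i)) supp.
rewrite pattern_polyE.
set x := \sum_i y (inl i) in xw *; set w := \sum_i y (inr i) in xw *.
set p2 := power_sum 2 _; set T := \sum_i \sum_j \sum_k _.
case=> a [b [a_ge0 b_ge0 abw ab2 lag]].
have x_ge0 : 0 <= x by exact: sumr_ge0.
have w_ge0 : 0 <= w by exact: sumr_ge0.
have n0 : 0 < n%:R :> R by rewrite ltr0n.
have leT : T <= x ^+ 3 - (w0 / (1 - w0)) ^+ 2 * x ^+ 3.
  rewrite -(ler_pM2l (exprn_gt0 2 n0)).
  have := distinct_triples_le (fun i => y_ge0 (inl i)).
  rewrite card_ord -/x -/T => /le_trans; apply.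
  have -> : n%:R ^+ 2 * (x ^+ 3 - (w0 / (1 - w0)) ^+ 2 * x ^+ 3) =
    (n%:R ^+ 2 - (w0 / (1 - w0)) ^+ 2 * n%:R ^+ 2) * x ^+ 3 by ring.
  by rewrite w0n le_eqVlt; apply/orP; left; apply/eqP; ring.
have gap := cubic_gap w0_gt0 w0_le x_ge0 w_ge0 xw a_ge0 b_ge0 abw.
have xp2 : 3 * x * (a ^+ 2 + b ^+ 2) <= 3 * x * p2.
  by rewrite ler_wpM2l // mulr_ge0.
have cube : x ^+ 3 + 3 * x ^+ 2 * w + 3 * x * w ^+ 2 + w ^+ 3 = 1.
  by transitivity ((x + w) ^+ 3); [ring | rewrite xw expr1n].
lra.
Qed.

(** With weight [1 - w0] spread evenly over the V_i and [w0] over W, the coincidences in W lose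
    [3 (1 - w0) w0^2 / t] and [S] gains [6 #|S| w0^3 / t^3]; the density hypothesis says that the
    gain is larger. *)
Lemma pattern_poly_gt :
  (0 < t)%N -> (1 - w0) * t%:R ^+ 2 < 2 * w0 * #|S|%:R ->
  exists y : 'I_n + 'I_t -> R, [/\ forall j, 0 <= y j, \sum_j y j = 1
    & 1 - w0 ^+ 2 < pattern_poly S y].
Proof.
have w01 : 0 < 1 - w0 by rewrite subr_gt0 (le_lt_trans w0_le) // ltr_pdivrMr // mul1r ltr1n.
move=> t_gt0 denseS.
have n0 : 0 < n%:R :> R by rewrite ltr0n.
have t0 : 0 < t%:R :> R by rewrite ltr0n.
pose y (j : 'I_n + 'I_t) : R := if j is inl _ then (1 - w0) / n%:R else w0 / t%:R.
have sum_c (m : nat) (c : R) : \sum_(i < m) c = m%:R * c.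
  by rewrite sumr_const card_ord mulr_natl.
have xE : n%:R * ((1 - w0) / n%:R) = 1 - w0 by rewrite mulrC divfK ?gt_eqF.
have wE : t%:R * (w0 / t%:R) = w0 by rewrite mulrC divfK ?gt_eqF.
exists y; split.
- by case=> i; rewrite divr_ge0 // ltW.
- by rewrite big_sumType /= !sum_c xE wE subrK.
rewrite pattern_polyE sum_distinct_triples /power_sum /= !sum_c expr1 xE wE.
have -> : lagrange S (fun i : 'I_t => w0 / t%:R) =
    6 * #|S|%:R * (w0 / t%:R) ^+ 3.
  rewrite lagrange_edges // -mulrA; congr (_ * _).
  rewrite (eq_bigr (fun=> (w0 / t%:R) ^+ 3)) => [|e eS].
    by rewrite sumr_const mulr_natl.
  by rewrite prodr_const (eqP (forall_inP uS e eS)).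
have w0n' : w0 ^+ 2 * n%:R ^+ 2 = (3 * n%:R - 2) * (1 - w0) ^+ 2.
  by rewrite -w0n; field; lra.
(* Adding the mixed terms without the loss in W gives [1 - w0^3 - (1 - w0) w0^2 = 1 - w0^2], so only
   the loss and the gain from [S] remain. *)
have tri : (1 - w0) ^+ 3 - 3 * (1 - w0) * (n%:R * ((1 - w0) / n%:R) ^+ 2) +
    2 * (n%:R * ((1 - w0) / n%:R) ^+ 3) = (1 - w0) ^+ 3 - (1 - w0) * w0 ^+ 2.
  have -> : w0 ^+ 2 = (3 * n%:R - 2) * (1 - w0) ^+ 2 / n%:R ^+ 2.
    by rewrite -w0n' mulfK // expf_neq0 // gt_eqF.
  by field; lra.
rewrite tri -subr_gt0.
set L := (X in 0 < X).
have -> : L = 3 * w0 ^+ 2 / t%:R ^+ 3 *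
    (2 * w0 * #|S|%:R - (1 - w0) * t%:R ^+ 2) by rewrite /L; field; lra.
by rewrite !mulr_gt0 ?invr_gt0 ?exprn_gt0 // subr_gt0.
Qed.
End PatternBounds.

(** * The families F_s *)

Definition dense_subgraphs (R : realType) (alpha : R) (s : nat) : set (rgraph 3) :=
  [set H : rgraph 3 | (nverts H <= s)%N /\ exists w : 'I_(nverts H) -> R,
    [/\ forall v, 0 <= w v, \sum_v w v = 1 & alpha < lagrange (edges H) w]]%classic.

Lemma turan_density_dense_subgraphs_le (R : realType) (alpha : R) (s : nat) :
  0 <= alpha -> (3 <= s)%N ->
  turan_density R (dense_subgraphs alpha s) <=
  alpha * s%:R ^+ 2 / ((s%:R - 1) * (s%:R - 2)).
Proof.
move=> alpha_ge0 s3; apply: (le_trans (turan_density_le R _ s3)).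
have s3' : 3 <= s%:R :> R by rewrite ler_nat.
have [->|[E [uE freeE ->]]] := ex_turan_attained s (dense_subgraphs alpha s).
  by rewrite mul0r !mulr_ge0 ?invr_ge0 ?mulr_ge0 //; lra.
(* Uniform weights are tested on [E] itself: a value above [alpha] would make [E] a member of the
   family, contained in [E]. *)
have le_lag : lagrange E (fun=> s%:R^-1) <= alpha.
  rewrite leNgt; apply/negP => lt_lag.
  apply: (freeE (RGraph uE)); last first.
    by exists id; split=> // e; rewrite imset_id.
  split=> //; exists (fun=> s%:R^-1); split=> //.
  by rewrite sumr_const card_ord -[LHS]mulr_natr mulVf // gt_eqF //; lra.
have edges_le : 6 * #|E|%:R <= alpha * s%:R ^+ 3.
  move: le_lag; rewrite lagrange_edges // (eq_bigr (fun=> s%:R^-1 ^+ 3)).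
    rewrite sumr_const -[X in 6 * X]mulr_natl mulrA exprVn ler_pdivrMr // exprn_gt0 //; lra.
  by move=> e eE; rewrite prodr_const (eqP (forall_inP uE e eE)).
have C6 : 'C(s, 3)%:R * 6 = s%:R * (s%:R - 1) * (s%:R - 2) :> R := bin3_natr R s.
have C_gt0 : 0 < 'C(s, 3)%:R :> R by rewrite ltr0n bin_gt0.
have q_gt0 : 0 < (s%:R - 1) * (s%:R - 2) :> R by rewrite mulr_gt0 //; lra.
rewrite ler_pdivrMr // mulrAC ler_pdivlMr // -(@ler_pM2l _ (6 * s%:R)); last by lra.
have -> : 6 * s%:R * (alpha * s%:R ^+ 2 * 'C(s, 3)%:R) =
   alpha * s%:R ^+ 3 * ('C(s, 3)%:R * 6) :> R by ring.
have -> : 6 * s%:R * (#|E|%:R * ((s%:R - 1) * (s%:R - 2))) =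
   6 * #|E|%:R * ('C(s, 3)%:R * 6) :> R by rewrite C6; ring.
by rewrite ler_wpM2r // mulr_ge0 // ltW.
Qed.

(** The lower bound [pattern_poly S y] on the density of the random blow-ups does not depend on [m],
    so the strict inequality survives the limit. *)
Lemma turan_density_dense_subgraphs_gt (R : realType) (n s : nat) (w0 : R) :
  (0 < n)%N -> 0 < w0 -> w0 <= 1 / 2 ->
  (w0 / (1 - w0)) ^+ 2 * n%:R ^+ 2 = 3 * n%:R - 2 ->
  1 - w0 ^+ 2 < turan_density R (dense_subgraphs (1 - w0 ^+ 2) s).
Proof.
move=> n_gt0 w0_gt0 w0_le w0n; set alpha := 1 - w0 ^+ 2.
have q_ge0 : 0 <= (1 - w0) / (2 * w0) by rewrite divr_ge0 //; lra.
(* This [C] makes [C * t ^ 2] edges enough for the density hypothesis of [pattern_poly_gt]. *)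
have ltC := archi_boundP q_ge0; set C := Num.bound _ in ltC.
have [t [S [t_gt0 uS sparse leS]]] := sparse_triple_system C s.
have t2_gt0 : 0 < t%:R ^+ 2 :> R by rewrite exprn_gt0 ?ltr0n.
have [|y [y_ge0 y1 gt_alpha]] := pattern_poly_gt n_gt0 w0_gt0 w0_le w0n uS t_gt0.
  have : (C%:R * t%:R ^+ 2 : R) <= #|S|%:R by rewrite -natrX -natrM ler_nat.
  move: ltC; rewrite ltr_pdivrMr; last by lra.
  rewrite -(ltr_pM2r t2_gt0) => lt1 le2; apply: (lt_le_trans lt1).
  by rewrite mulrAC [leLHS]mulrC ler_pM2l //; lra.
apply: (lt_le_trans gt_alpha); apply: turan_density_ge => m m3.
have [phi] := random_blowup S 'I_m y_ge0 y1; rewrite card_ord => le_phi.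
have C_gt0 : 0 < 'C(m, 3)%:R :> R by rewrite ltr0n bin_gt0.
rewrite ler_pdivlMr //; apply: (le_trans le_phi); rewrite ler_nat.
apply: leq_ex_turan; first exact: blowup_uniform.
move=> H [Hs [w [w_ge0 w1 lt_lag]]] [f [f_inj fH]].
(* A copy of a family member would carry its weights to the pattern and give a value above [alpha]
   there, against [pattern_poly_le]. *)
have le_push : lagrange (edges H) w <=
    pattern_poly S (fun j => \sum_(v | phi (f v) == j) w v).
  apply: (lagrange_le_pattern (psi := phi \o f)) => // a b c /fH.
  by rewrite !imsetU !imset_set1 in_blowup => /andP[].
move: lt_lag; rewrite ltNge => /negP; apply; apply: (le_trans le_push).
apply: (pattern_poly_le n_gt0 w0_gt0 w0_le w0n uS sparse).
- by move=> j; apply: sumr_ge0.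
- by rewrite -w1 [RHS](partition_big (phi \o f) xpredT).
(* Points of W that receive nonzero weight are images of vertices of [H], of which there are at most
   [s]. *)
apply: leq_trans Hs; rewrite -[leqRHS]card_ord -cardsT.
have inr_inj : injective (@inr 'I_n 'I_t) by move=> i j [].
rewrite -(card_imset _ inr_inj).
apply: leq_trans (leq_imset_card (phi \o f) _); apply: subset_leq_card.
apply/subsetP => _ /imsetP[i + ->]; rewrite inE => sum_neq0.
apply/imsetP; apply: contrapT => no_v; case/negP: sum_neq0.
rewrite big_pred0 // => v; apply/negbTE/negP => /eqP ev; apply: no_v.
by exists v; rewrite ?inE.
Qed.

Local Open Scope classical_set_scope.
Local Open Scope ring_scope.

Theorem theorem1p6 (R : realType) (n : nat) (k : R)
    (hn : (0 < n)%N) (hk : k = Num.sqrt (3 * n%:R - 2)) :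
  ~ jump 3 (1 - (3 * n%:R ^+ 2 - 2 * n%:R + k ^+ 3) / (n%:R + k) ^+ 3).
Proof.
have n1 : 1 <= n%:R :> R by rewrite ler1n.
have rad_gt0 : 0 < 3 * n%:R - 2 :> R by lra.
have k_gt0 : 0 < k by rewrite hk sqrtr_gt0.
have k2 : k ^+ 2 = 3 * n%:R - 2 by rewrite hk sqr_sqrtr // ltW.
have k_le : k <= n%:R.
  suff : k ^+ 2 <= n%:R ^+ 2 by rewrite ler_sqr ?nnegrE // ltW.
  rewrite k2 -subr_ge0.
  (* Nonnegative because [n] is an integer: the product is negative only strictly between 1 and 2.
     The resulting [k <= n] gives [w0 <= 1 / 2]. *)
  have -> : n%:R ^+ 2 - (3 * n%:R - 2) = (n%:R - 1) * (n%:R - 2) :> R by ring.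
  move: hn; rewrite leq_eqVlt => /predU1P[<-|n2]; first by rewrite subrr mul0r.
  have : 2 <= n%:R :> R by rewrite ler_nat.
  by move=> ?; rewrite mulr_ge0 //; lra.
pose w0 := k / (n%:R + k).
have w0_gt0 : 0 < w0 by rewrite divr_gt0 //; lra.
have w0_le : w0 <= 1 / 2 by rewrite ler_pdivrMr; lra.
have w0n : (w0 / (1 - w0)) ^+ 2 * n%:R ^+ 2 = 3 * n%:R - 2.
  by rewrite -k2 /w0; field; lra.
have -> : 1 - (3 * n%:R ^+ 2 - 2 * n%:R + k ^+ 3) / (n%:R + k) ^+ 3 = 1 - w0 ^+ 2.
  have -> : 3 * n%:R ^+ 2 - 2 * n%:R = n%:R * k ^+ 2 by rewrite k2; ring.
  by rewrite /w0; field; lra.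
set alpha := 1 - w0 ^+ 2; case=> c [c_gt0 noF].
have alpha_ge0 : 0 <= alpha by rewrite /alpha; nra.
have alpha_le1 : alpha <= 1 by rewrite /alpha gerBl sqr_ge0.
(* The target inequality amounts to [alpha (3s - 2) < c (s - 1) (s - 2)]. With [B > 3 / c] and
   [s = B + 3], it follows from [3s - 2 < 3s < c (s - 3) s] and [alpha <= 1]. *)
have c3_ge0 : 0 <= 3 / c by rewrite divr_ge0 // ltW.
have lt_c := archi_boundP c3_ge0; set B := Num.bound _ in lt_c.
pose s := (B + 3)%N.
apply: (noF (dense_subgraphs alpha s)); split.
  exact: turan_density_dense_subgraphs_gt w0n.
apply: (le_lt_trans (turan_density_dense_subgraphs_le alpha_ge0 (leq_addl B 3))).
have -> : s%:R = B%:R + 3 :> R by rewrite natrD.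
have B_gt0 : 0 < B%:R :> R by exact: le_lt_trans lt_c.
move: lt_c; rewrite ltr_pdivrMr // => lt_c.
rewrite ltr_pdivrMr; last by rewrite mulr_gt0; lra.
have : 3 * (B%:R + 3) < B%:R * c * (B%:R + 3) by rewrite ltr_pM2r //; lra.
have : alpha * (3 * (B%:R + 3) - 2) <= 1 * (3 * (B%:R + 3) - 2).
  by rewrite ler_wpM2r //; lra.
rewrite -/s; nra.
Qed.
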